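(* Let $\mathcal{A}=(\mathbb{Z}/4\mathbb{Z};\cdot)$ be the linear cycle set with $\imath\cdot\jmath:=(1-2\imath)\jmath$, and let $\Gamma$ be an additive abelian group. For $\gamma,\gamma_1,\gamma'_1\in\Gamma$ with $4\gamma_1=2\gamma$ and $2\gamma'_1=0$, define maps $\overline{\xi}^1_{\gamma},\overline{\xi}^2_{\gamma_1,\gamma'_1,\gamma}\colon\mathbb{Z}/4\mathbb{Z}\times\mathbb{Z}/4\mathbb{Z}\to\Gamma$ by (with $0\le\imath_1,\imath_2<4$) $$\overline{\xi}^1_{\gamma}(\imath_1,\imath_2):=\begin{cases}\gamma&\text{if }\imath_1=\imath_2=1,\\-\gamma&\text{if }\imath_1,\imath_2\ge 2\text{ and }\imath_1+\imath_2\le 5,\\0&\text{otherwise,}\end{cases}$$ and, for $\imath,\jmath\in\{0,1\}$ and $0\le\imath_1<4$, $$\overline{\xi}^2_{\gamma_1,\gamma'_1,\gamma}(2\imath+\jmath,\imath_1):=\begin{cases}0&\text{if }\imath_1=0\text{ or }\imath=\jmath=0,\\-\gamma'_1&\text{if }\imath=1,\ \jmath=0,\ \imath_1\in\{1,3\},\\0&\text{if }\imath=1,\ \jmath=0,\ \imath_1=2,\\\gamma_1-\imath\gamma'_1&\text{if }\jmath=1,\ \imath_1=1,\\2\gamma_1-\gamma&\text{if }\jmath=1,\ \imath_1=2,\\-\gamma_1-\imath\gamma'_1&\text{if }\jmath=1,\ \imath_1=3.\end{cases}$$ Then: (1) For all such $\gamma,\gamma_1,\gamma_1'$, the set $\Gamma\times\mathbb{Z}/4\mathbb{Z}$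 is a linear cycle set via $$(c,\imath)+(c',\imath'):=\bigl(c+c'+\overline{\xi}^1_{\gamma}(\imath,\imath'),\imath+\imath'\bigr),\qquad (c,\imath)\cdot(c',\imath'):=\bigl(c'+\overline{\xi}^2_{\gamma_1,\gamma'_1,\gamma}(\imath,\imath'),\imath\cdot\imath'\bigr),$$ and, with $\iota(c):=(c,0)$ and $\pi(c,\imath):=\imath$, the sequence $0\to\Gamma\xrightarrow{\iota}\Gamma\times\mathbb{Z}/4\mathbb{Z}\xrightarrow{\pi}\mathbb{Z}/4\mathbb{Z}\to 0$ is a central extension of $\mathcal{A}$ by $\Gamma$. (2) The extensions associated with $(\overline{\xi}^1_{\gamma},\overline{\xi}^2_{\gamma_1,\gamma'_1,\gamma})$ and $(\overline{\xi}^1_{\overline{\gamma}},\overline{\xi}^2_{\overline{\gamma}_1,\overline{\gamma}'_1,\overline{\gamma}})$ are equivalent if and only if $\gamma_1-\overline{\gamma}_1\in2\Gamma$, $\gamma-\overline{\gamma}=2(\gamma_1-\overline{\gamma}_1)$ and $\overline{\gamma}'_1=\gamma'_1$; and each central extension of $\mathcal{A}$ by $\Gamma$ is equivalent to one of these.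
   Context: A linear cycle set is an abelian group $(A,+)$ with a binary operation $\cdot$ such that every left translation $a\mapsto a'\cdot a$ is bijective and, for all $a,b,c\in A$, $(a\cdot b)\cdot(a\cdot c)=(b\cdot a)\cdot(b\cdot c)$, $a\cdot(b+c)=a\cdot b+a\cdot c$ and $(a+b)\cdot c=(a\cdot b)\cdot(a\cdot c)$. Morphisms preserve $+$ and $\cdot$. A central extension of a linear cycle set $A$ by an abelian group $\Gamma$ is a short exact sequence $0\to\Gamma\xrightarrow{\iota}E\xrightarrow{\pi}A\to0$ of linear cycle sets (i.e. of morphisms of linear cycle sets, exact as a sequence of abelian groups), where $\Gamma$ carries the trivial operation $c\cdot c'=c'$, and $\iota(\Gamma)$ is central in $E$: $\iota(c)\cdot e=e$ and $e\cdot\iota(c)=\iota(c)$ for all $c\in\Gamma$, $e\in E$. Two central extensions $E,E'$ of $A$ by $\Gamma$ are equivalent if there is an isomorphism of linear cycle sets $E\to E'$ compatible with the maps from $\Gamma$ and to $A$. *)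

(* Defs.v *)
From mathcomp Require Import all_boot all_algebra.

Set Implicit Arguments.
Unset Strict Implicit.
Unset Printing Implicit Defensive.

Import GRing.Theory.

Local Open Scope ring_scope.

(* Linear cycle sets are predicates on a pair of operations over a bare type,
   so that a non-canonical addition can be put on a product type. *)

Definition is_abelian_group (T : Type) (add : T -> T -> T) : Prop :=
  [/\ associative add,
      commutative add &
      exists (zero : T) (opp : T -> T),
        left_id zero add /\ left_inverse zero opp add].

Record is_linear_cycle_set (T : Type) (add dot : T -> T -> T) : Prop := {
  lcs_group : is_abelian_group add;
  lcs_bij : forall a, bijective (dot a);
  lcs_cycle : forall a b c,
    dot (dot a b) (dot a c) = dot (dot b a) (dot b c);
  lcs_dotDr : forall a b c, dot a (add b c) = add (dot a b) (dot a c);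
  lcs_dotDl : forall a b c, dot (add a b) c = dot (dot a b) (dot a c)
}.

Definition is_lcs_morphism (T U : Type) (addT dotT : T -> T -> T)
    (addU dotU : U -> U -> U) (f : T -> U) : Prop :=
  {morph f : x y / addT x y >-> addU x y} /\
  {morph f : x y / dotT x y >-> dotU x y}.

Definition trivial_dot (T : Type) (c c' : T) : T := c'.

(* The data Gamma -> E -> A, with operations on E but no axioms. *)
Record extension (Gamma A : Type) := Extension {
  ext_sort :> Type;
  ext_add : ext_sort -> ext_sort -> ext_sort;
  ext_dot : ext_sort -> ext_sort -> ext_sort;
  ext_inj : Gamma -> ext_sort;
  ext_proj : ext_sort -> A
}.

Record is_central_extension (Gamma A : zmodType) (dotA : A -> A -> A)
    (E : extension Gamma A) : Prop := {
  cext_base : is_linear_cycle_set (@GRing.add A) dotA;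
  cext_lcs : is_linear_cycle_set (@ext_add _ _ E) (@ext_dot _ _ E);
  cext_inj_morph : is_lcs_morphism (@GRing.add Gamma) (@trivial_dot Gamma)
    (@ext_add _ _ E) (@ext_dot _ _ E) (@ext_inj _ _ E);
  cext_proj_morph : is_lcs_morphism (@ext_add _ _ E) (@ext_dot _ _ E)
    (@GRing.add A) dotA (@ext_proj _ _ E);
  cext_injective : injective (@ext_inj _ _ E);
  cext_exact : forall e : E,
    ext_proj e = 0 <-> exists c : Gamma, ext_inj E c = e;
  cext_surjective : forall a : A, exists e : E, ext_proj e = a;
  cext_central_l : forall (c : Gamma) (e : E), ext_dot (ext_inj E c) e = e;
  cext_central_r : forall (c : Gamma) (e : E),
    ext_dot e (ext_inj E c) = ext_inj E c
}.

Definition equivalent_extensions (Gamma A : Type)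
    (E E' : extension Gamma A) : Prop :=
  exists phi : E -> E',
    [/\ bijective phi,
        is_lcs_morphism (@ext_add _ _ E) (@ext_dot _ _ E)
                        (@ext_add _ _ E') (@ext_dot _ _ E') phi,
        forall c : Gamma, phi (ext_inj E c) = ext_inj E' c &
        forall e : E, ext_proj (phi e) = ext_proj e].

Definition dotZ4 (i j : 'Z_4) : 'Z_4 := (1 - 2%:R * i) * j.

(* Case conditions are on the representatives in {0, 1, 2, 3}, as naturals. *)
Definition xi1 (Gamma : zmodType) (gamma : Gamma) (i1 i2 : 'Z_4) : Gamma :=
  let m := nat_of_ord i1 in
  let n := nat_of_ord i2 in
  if (m == 1%N) && (n == 1%N) then gamma
  else if [&& (2 <= m)%N, (2 <= n)%N & (m + n <= 5)%N] then - gamma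
  else 0.

(* The first argument is k = 2 i + j with i, j in {0, 1}. *)
Definition xi2 (Gamma : zmodType) (gamma1 gamma1' gamma : Gamma)
    (k i1 : 'Z_4) : Gamma :=
  let i := (nat_of_ord k %/ 2)%N in
  let j := (nat_of_ord k %% 2)%N in
  let n := nat_of_ord i1 in
  if (n == 0%N) || ((i == 0%N) && (j == 0%N)) then 0
  else if j == 0%N then (if n == 2%N then 0 else - gamma1')
  else if n == 1%N then gamma1 - gamma1' *+ i
  else if n == 2%N then gamma1 *+ 2 - gamma
  else - gamma1 - gamma1' *+ i.

Definition xi_extension (Gamma : zmodType) (gamma1 gamma1' gamma : Gamma) :
    extension Gamma 'Z_4 :=
  @Extension Gamma 'Z_4 (Gamma * 'Z_4)%type
    (fun x y => (x.1 + y.1 + xi1 gamma x.2 y.2, x.2 + y.2))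
    (fun x y => (y.1 + xi2 gamma1 gamma1' gamma x.2 y.2, dotZ4 x.2 y.2))
    (fun c => (c, 0))
    (fun x => x.2).

Definition admissible (Gamma : zmodType) (gamma1 gamma1' gamma : Gamma) : Prop :=
  gamma1 *+ 4 = gamma *+ 2 /\ gamma1' *+ 2 = 0.

(* Main.v *)
(* The maps xi1 and xi2 take their values in the subgroup generated by gamma,
   gamma1, gamma1', so each identity between them is a congruence between
   vectors of Z^3 modulo the relations 4 gamma1 = 2 gamma, 2 gamma1' = 0; over
   'Z_4 there are finitely many such congruences, checked by computation.
   Conversely, an element e of a central extension lying over 1 determines
   gamma = 4 e, gamma1 = e.e + e and gamma1' = e - (2 e).e in Gamma. As left
   translations are additive, these values give both operations with respect to
   the section 0, e, -2 e, -e, and the resulting cocycle is (xi1, xi2).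
   Replacing e by e + t changes (gamma, gamma1, gamma1') to
   (gamma + 4 t, gamma1 + 2 t, gamma1'), whence the equivalence criterion. *)

From HB Require Import structures.
Require Import Defs.
From mathcomp Require Import all_boot all_algebra boolp.

Set Implicit Arguments.
Unset Strict Implicit.
Unset Printing Implicit Defensive.

Import GRing.Theory.

Local Open Scope ring_scope.

(** * Integer combinations of three generators, modulo relations *)

Lemma Z4_ind (P : 'Z_4 -> Prop) : P 0 -> P 1 -> P 2%:R -> P 3%:R -> forall i, P i.
Proof.
move=> P0 P1 P2 P3 [[|[|[|[|//]]]] lt_i4].
- by rewrite (_ : Ordinal _ = 0) //; apply: val_inj.
- by rewrite (_ : Ordinal _ = 1) //; apply: val_inj.
- by rewrite (_ : Ordinal _ = 2%:R) //; apply: val_inj.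
- by rewrite (_ : Ordinal _ = 3%:R) //; apply: val_inj.
Qed.

Definition comb (M : zmodType) (x y z : M) (v : int * int * int) : M :=
  x *~ v.1.1 + y *~ v.1.2 + z *~ v.2.

Lemma combD (M : zmodType) (x y z : M) v w :
  comb x y z (v + w) = comb x y z v + comb x y z w.
Proof.
by rewrite /comb /= !mulrzDr [RHS]addrACA; congr (_ + _); rewrite addrACA.
Qed.

Lemma combN (M : zmodType) (x y z : M) v : comb x y z (- v) = - comb x y z v.
Proof. by rewrite /comb /= !mulrNz !opprD. Qed.

(* Membership in the lattice generated by (- m, 4, 0) and (0, 0, 2): these are
   the relations 4 y = m x and 2 z = 0 for the generators x, y, z of comb. *)
Definition rel_lattice (m : int) (v : int * int * int) : bool :=
  [&& (4%:Z %| v.1.2)%Z, (2%:Z %| v.2)%Z & v.1.1 == - (m * (v.1.2 %/ 4%:Z)%Z)].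

Lemma comb_eq (M : zmodType) (x y z : M) (m : int) v w :
    y *~ 4 = x *~ m -> z *~ 2 = 0 -> rel_lattice m (v - w) ->
  comb x y z v = comb x y z w.
Proof.
move=> yx z0 /and3P[/divzK d4 /divzK d2 /eqP e1].
apply/eqP; rewrite -subr_eq0 -combN -combD /comb -d2 -d4 e1 /=.
rewrite ![_ * 4]mulrC ![_ * 2]mulrC.
rewrite [y *~ _]mulrzA [z *~ _]mulrzA yx z0 mul0rz addr0 -mulrzA -mulrzDr.
by rewrite addNr.
Qed.

(** [xi1] is built from its parameter by group operations alone, so it commutes with the
    homomorphism [comb g g1 g1'] from Z^3; over Z^3 its values can be computed. *)
Lemma xi1_comb (G : zmodType) (g g1 g1' : G) i j :
  xi1 g i j = comb g g1 g1' (xi1 (1, 0, 0) i j).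
Proof.
rewrite /xi1; do 2? case: ifP => _; rewrite /comb /= !mulr0z.
all: by rewrite ?mulrN1z ?addr0.
Qed.

(* The argument order of xi2 is (gamma1, gamma1', gamma), that of comb is
   (gamma, gamma1, gamma1'), hence the permuted unit vectors. *)
Lemma xi2_comb (G : zmodType) (g g1 g1' : G) k i :
  xi2 g1 g1' g k i = comb g g1 g1' (xi2 (0, 1, 0) (0, 0, 1) (1, 0, 0) k i).
Proof.
have combMn v n : comb g g1 g1' (v *+ n) = comb g g1 g1' v *+ n.
  by elim: n => [|n IHn]; rewrite ?mulrS ?combD ?IHn // /comb /= !mulr0z !addr0.
have c0 : comb g g1 g1' 0 = 0 by rewrite /comb /= !mulr0z !addr0.
have cg : comb g g1 g1' (1, 0, 0) = g by rewrite /comb /= !mulr0z !addr0.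
have cg1 : comb g g1 g1' (0, 1, 0) = g1 by rewrite /comb /= !mulr0z !addr0 add0r.
have cg1' : comb g g1 g1' (0, 0, 1) = g1' by rewrite /comb /= !mulr0z !add0r.
rewrite /xi2; do 5? case: ifP => _ //.
all: by rewrite ?(combD, combN, combMn) ?c0 ?cg ?cg1 ?cg1'.
Qed.

(** * The base linear cycle set and the extensions [xi_extension] *)

Lemma dotZ4_lcs : is_linear_cycle_set (@GRing.add 'Z_4) dotZ4.
Proof.
(* Translations are involutions because (1 - 2a)^2 = 1 modulo 4. *)
have dotK a : cancel (dotZ4 a) (dotZ4 a).
  by move=> b; apply/val_inj; move: a b; do 2! elim/Z4_ind.
have dotDl a b c : dotZ4 (a + b) c = dotZ4 (dotZ4 a b) (dotZ4 a c).
  by apply/val_inj; move: a b c; do 3! elim/Z4_ind.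
split=> //.
- split; [exact: addrA | exact: addrC | exists 0, -%R].
  by split; [exact: add0r | exact: addNr].
- by move=> a; exists (dotZ4 a).
(* Both sides of the cycle identity equal (a + b).c. *)
- by move=> a b c; rewrite -!dotDl addrC.
- by move=> a b c; rewrite /dotZ4 mulrDr.
Qed.

Lemma xi1_0l (G : zmodType) (g : G) k : xi1 g 0 k = 0.
Proof. by elim/Z4_ind: k. Qed.

Section XiCocycle.

Variables (G : zmodType) (g g1 g1' : G).
Hypothesis adm : admissible g1 g1' g.

Let comb_adm v w : rel_lattice 2 (v - w) -> comb g g1 g1' v = comb g g1 g1' w.
Proof. by case: adm => gg1 g1'0; apply: comb_eq. Qed.

Lemma xi1_sym i j : xi1 g i j = xi1 g j i.
Proof. by move: i j; do 2! elim/Z4_ind. Qed.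

(** This identity and the next two are the Gamma-components, in [xi_extension], of associativity and
    of the laws for a.(b + c) and (a + b).c. *)
Lemma xi1_cocycle i j k :
  xi1 g j k + xi1 g i (j + k) = xi1 g i j + xi1 g (i + j) k.
Proof.
rewrite !(xi1_comb g g1 g1') -!combD; apply: comb_adm.
by move: i j k; do 3! elim/Z4_ind; vm_compute.
Qed.

Lemma xi2_xi1_r i j k :
  xi1 g j k + xi2 g1 g1' g i (j + k)
  = xi2 g1 g1' g i j + xi2 g1 g1' g i k + xi1 g (dotZ4 i j) (dotZ4 i k).
Proof.
rewrite !(xi1_comb g g1 g1') !(xi2_comb g g1 g1') -!combD; apply: comb_adm.
by move: i j k; do 3! elim/Z4_ind; vm_compute.
Qed.

Lemma xi2_add_l i j k :
  xi2 g1 g1' g (i + j) k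
  = xi2 g1 g1' g i k + xi2 g1 g1' g (dotZ4 i j) (dotZ4 i k).
Proof.
rewrite !(xi2_comb g g1 g1') -!combD; apply: comb_adm.
by move: i j k; do 3! elim/Z4_ind; vm_compute.
Qed.

Lemma xi_central_extension : is_central_extension dotZ4 (xi_extension g1 g1' g).
Proof.
have xi1_0l := xi1_0l g.
have xi2_0l k : xi2 g1 g1' g 0 k = 0 by move: k; elim/Z4_ind.
have xi2_0r k : xi2 g1 g1' g k 0 = 0 by move: k; elim/Z4_ind.
have dot0 k : dotZ4 0 k = k by rewrite /dotZ4 mulr0 subr0 mul1r.
have dotr0 k : dotZ4 k 0 = 0 by rewrite /dotZ4 mulr0.
have dotK k i : dotZ4 k (dotZ4 k i) = i.
  by apply/val_inj; move: k i; do 2! elim/Z4_ind.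
have [_ _ _ dotDr dotDl] := dotZ4_lcs.
have dotDlE (x y z : xi_extension g1 g1' g) :
    ext_dot (ext_add x y) z = ext_dot (ext_dot x y) (ext_dot x z).
  case: x y z => [c i] [d j] [e k]; congr pair => /=; last exact: dotDl.
  by rewrite xi2_add_l addrA.
have addC : commutative (@ext_add _ _ (xi_extension g1 g1' g)).
  by move=> [c i] [d j]; rewrite /= xi1_sym [c + d]addrC [i + j]addrC.
split=> //; first exact: dotZ4_lcs.
- split=> //.
  + split=> //.
    * move=> [c i] [d j] [e k]; congr pair => /=; last exact: addrA.
      rewrite -[LHS]addrA -[d + e + _ + _]addrA xi1_cocycle !addrA.
      by rewrite (addrAC _ e).
    * exists (0, 0), (fun x => (- x.1 - xi1 g (- x.2) x.2, - x.2)).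
      split=> -[c i] /=; first by rewrite xi1_0l !add0r addr0.
      by rewrite addrAC subrK !addNr.
  + move=> [c i].
    exists (fun y => (y.1 - xi2 g1 g1' g i (dotZ4 i y.2), dotZ4 i y.2)).
      by move=> [d j] /=; rewrite dotK addrK.
    by move=> [d j] /=; rewrite dotK subrK.
  + by move=> x y z; rewrite -!dotDlE addC.
  + move=> [c i] [d j] [e k]; congr pair => /=; last exact: dotDr.
    by rewrite -addrA xi2_xi1_r addrA (addrACA d e).
- split=> c d /=; first by rewrite xi1_0l !addr0.
  by rewrite /trivial_dot xi2_0l dot0 addr0.
- by move=> c d [].
- move=> [c i] /=; split=> [->|[d [_ <-]] //].
  by exists c.
- by move=> a; exists (0, a).
- by move=> c [d j] /=; rewrite xi2_0l dot0 addr0.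
- by move=> c [d j] /=; rewrite xi2_0r dotr0 addr0.
Qed.
End XiCocycle.

(** * Classification of central extensions through an element over 1 *)

Lemma morph_mulrz (U V : zmodType) (f : U -> V) :
  {morph f : x y / x + y} -> forall n, {morph f : x / x *~ n}.
Proof.
move=> fD n x.
have f0 : f 0 = 0 by apply: (addIr (f 0)); rewrite -fD !add0r.
have fB : zmod_morphism f.
  by move=> y z; apply: (addIr (f z)); rewrite -fD !subrK.
pose F : {additive U -> V} := HB.pack f (GRing.isZmodMorphism.Build U V f fB).
exact: (raddfMz F).
Qed.

(* Classical choice equips the bare carrier with a choiceType structure, hence
   with a zmodType structure whose addition is convertible to ext_add. *)
Lemma central_extension_zmod (G A : zmodType) (dotA : A -> A -> A)
    (E : extension G A) :
    is_central_extension dotA E ->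
  exists (M : zmodType) (dot : M -> M -> M) (inj : G -> M) (proj : M -> A),
    E = Extension +%R dot inj proj.
Proof.
case: E => T add dot inj proj.
case=> _ [/= [addA addC [zero [opp [add0 addN]]]] _ _ _ _] _ _ _ _ _ _ _.
pose M : zmodType := HB.pack {classic T}
  (@GRing.isZmodule.Build {classic T} zero opp add addA addC add0 addN).
by exists M, dot, inj, proj.
Qed.

Section Classification.

Variables (G M : zmodType) (dot : M -> M -> M) (inj : G -> M) (proj : M -> 'Z_4).
Let E : extension G 'Z_4 := Extension +%R dot inj proj.
Hypothesis centE : is_central_extension dotZ4 E.

Let injD : {morph inj : x y / x + y} := (cext_inj_morph centE).1.
Let projD : {morph proj : x y / x + y} := (cext_proj_morph centE).1.
Let projM : {morph proj : x y / dot x y >-> dotZ4 x y} := (cext_proj_morph centE).2.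
Let inj_inj : injective inj := cext_injective centE.
Let injl c x : dot (inj c) x = x := cext_central_l centE c x.
Let injr c x : dot x (inj c) = inj c := cext_central_r centE c x.
Let dotDr x y z : dot x (y + z) = dot x y + dot x z := lcs_dotDr (cext_lcs centE) x y z.
Let dotDl x y z : dot (x + y) z = dot (dot x y) (dot x z) :=
  lcs_dotDl (cext_lcs centE) x y z.
Let exactE x : proj x = 0 <-> exists c, inj c = x := cext_exact centE x.

Let injMz := morph_mulrz injD.
Let projMz := morph_mulrz projD.
Let dotMz x := morph_mulrz (dotDr x).

Let injlD c x y : dot (inj c + x) y = dot x y.
Proof. by rewrite dotDl !injl. Qed.

(** Modulo 4 one has 4 = 0, 1.1 = -1 and 2.1 = 1, so 4 e, e.e + e and e - (2 e).e lie in the kernel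
    of [proj], which is the image of Gamma. *)
Lemma generator_data : exists (e : M) (g g1 g1' : G),
  [/\ proj e = 1, e *~ 4 = inj g, dot e e = inj g1 - e & dot (e *~ 2) e = e - inj g1'].
Proof.
have [e /= e1] := cext_surjective centE 1.
have projN x : proj (- x) = - proj x by rewrite -mulrN1z projMz mulrN1z.
have [g gE] : exists g, inj g = e *~ 4.
  by apply/exactE; rewrite projMz e1; apply: val_inj.
have [g1 g1E] : exists g, inj g = dot e e + e.
  by apply/exactE; rewrite projD projM e1; apply: val_inj.
have [g1' g1'E] : exists g, inj g = e - dot (e *~ 2) e.
  by apply/exactE; rewrite projD projN projM projMz e1; apply: val_inj.
exists e, g, g1, g1'; split=> //; first by rewrite g1E addrK.
by rewrite g1'E subKr.
Qed.

Variables (e : M) (g g1 g1' : G).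
Hypotheses (proj_e : proj e = 1) (e4 : e *~ 4 = inj g)
  (dot_ee : dot e e = inj g1 - e) (dot_2ee : dot (e *~ 2) e = e - inj g1').

(* Compare e.(4 e) = 4 (e.e) with e.(4 e) = 4 e, as 4 e is central. *)
Lemma rel_g1 : inj g1 *~ 4 = e *~ 8.
Proof.
have: dot e (e *~ 4) = e *~ 4 by rewrite e4 injr.
rewrite dotMz dot_ee mulrzDl mulNrz => /eqP; rewrite subr_eq => /eqP ->.
by rewrite -mulrzDr.
Qed.

(* Compare (4 e).e = ((2 e).(2 e)).((2 e).e) with (4 e).e = e. *)
Lemma rel_g1' : inj g1' *~ 2 = 0.
Proof.
have dotBi x y c : dot x (y - inj c) = dot x y - inj c.
  by rewrite -mulrN1z -injMz dotDr injr.
have dotlB x y c : dot (x - inj c) y = dot x y.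
  by rewrite -mulrN1z -injMz addrC injlD.
have: dot (e *~ 2 + e *~ 2) e = e by rewrite -mulrzDr e4 injl.
rewrite dotDl dotMz dot_2ee mulrzDl mulNrz -injMz dotlB dotBi dot_2ee => /eqP.
rewrite -addrA -opprD => /eqP /(canRL (addKr e)) /eqP.
rewrite addNr oppr_eq0 => /eqP <-.
by rewrite injMz (mulrzDr (inj g1') 1 1).
Qed.

Lemma classify_admissible : admissible g1 g1' g.
Proof.
split; apply: inj_inj.
- by rewrite !pmulrn !injMz rel_g1 -e4 -mulrzA.
- by rewrite pmulrn injMz rel_g1' -[in RHS](mulr0z 0) injMz mulr0z.
Qed.

(* The multiples of e representing 'Z_4: sec 2 = -2 and sec 3 = -1 rather than
   2 and 3, because xi1 is the cocycle of this section. *)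
Let sec (k : 'Z_4) : int := [:: 0; 1; -2; -1]`_k.

Lemma proj_sec k : proj (e *~ sec k) = k.
Proof. by rewrite projMz proj_e; apply: val_inj; elim/Z4_ind: k. Qed.

Lemma inj_comb v :
  inj (comb g g1 g1' v) = comb e (inj g1) (inj g1') (4 * v.1.1, v.1.2, v.2).
Proof. by rewrite /comb /= !injD !injMz -e4 -mulrzA. Qed.

(** In [M] the generator g is replaced by e with g = 4 e, so 4 g1 = 2 g becomes 4 g1 = 8 e, whence
    the parameter 8. *)
Let comb_rel v w : rel_lattice 8 (v - w) ->
  comb e (inj g1) (inj g1') v = comb e (inj g1) (inj g1') w.
Proof. exact: comb_eq rel_g1 rel_g1'. Qed.

Let combMz n v :
  comb e (inj g1) (inj g1') (v.1.1 * n, v.1.2 * n, v.2 * n)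
  = comb e (inj g1) (inj g1') v *~ n.
Proof. by rewrite /comb /= !mulrzA !mulrzDl. Qed.

Let comb_e n : e *~ n = comb e (inj g1) (inj g1') (n, 0, 0).
Proof. by rewrite /comb /= !mulr0z !addr0. Qed.

Lemma sec_add i j : e *~ sec i + e *~ sec j = inj (xi1 g i j) + e *~ sec (i + j).
Proof.
rewrite (xi1_comb g g1 g1') inj_comb !comb_e -!combD; apply: comb_rel.
by move: i j; do 2! elim/Z4_ind; vm_compute.
Qed.

Lemma dot_sec_e i :
  dot (e *~ sec i) e = inj (xi2 g1 g1' g i 1) + e *~ sec (dotZ4 i 1).
Proof.
have e0 : dot (e *~ 0) e = e by rewrite mulr0z -(mulr0z (inj g)) -injMz injl.
(* Adding 4 e, which is central, to the left factor turns -2 and -1 into 2 and 3; then 3 = 2 + 1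
   reduces to [dot_2ee] and [dot_ee]. *)
have e2 : dot (e *~ -2) e = e - inj g1'.
  by rewrite -[dot _ _](injlD g) -e4 -mulrzDr dot_2ee.
have e3 : dot (e *~ -1) e = inj g1 - e - inj g1'.
  rewrite -[dot _ _](injlD g) -e4 -mulrzDr (mulrzDr e 2 1) dotDl dot_2ee.
  by rewrite -mulrN1z -injMz [in dot _]addrC injlD dotDr injr dot_ee.
(* The list holds the coordinates over e, g1, g1' of the translates of e by 0, e, -2 e, -e. *)
have -> : dot (e *~ sec i) e = comb e (inj g1) (inj g1')
    [:: (1, 0, 0); (-1, 1, 0); (1, 0, -1); (-1, 1, -1)]`_i.
  elim/Z4_ind: i; rewrite /comb /=.
  - by rewrite e0 !mulr0z !addr0.
  - by rewrite dot_ee mulr0z addr0 mulrN1z addrC.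
  - by rewrite e2 mulr0z mulrN1z addr0.
  - by rewrite e3 !mulrN1z [- e + _]addrC.
rewrite (xi2_comb g g1 g1') inj_comb comb_e -combD; apply: comb_rel.
by elim/Z4_ind: i; vm_compute.
Qed.

Lemma dot_sec i j :
  dot (e *~ sec i) (e *~ sec j) = inj (xi2 g1 g1' g i j) + e *~ sec (dotZ4 i j).
Proof.
rewrite dotMz dot_sec_e !(xi2_comb g g1 g1') !inj_comb !comb_e -!combD -combMz.
apply: comb_rel.
by move: i j; do 2! elim/Z4_ind; vm_compute.
Qed.

Lemma classify_equivalent : equivalent_extensions E (xi_extension g1 g1' g).
Proof.
(* Each element of [M] is uniquely a sum of an element of Gamma and a representative [e *~ sec k];
   the equivalence is the inverse of [psi]. *)
pose psi (x : G * 'Z_4) : M := inj x.1 + e *~ sec x.2.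
have proj_inj c : proj (inj c) = 0 by apply/exactE; exists c.
have proj_psi x : proj (psi x) = x.2 by rewrite projD proj_inj add0r proj_sec.
have /choice[h hE] x : exists c, inj c = x - e *~ sec (proj x).
  apply/exactE.
  by rewrite projD -mulrN1z projMz proj_sec mulrN1z subrr.
pose phi x : G * 'Z_4 := (h x, proj x).
have phiK : cancel phi psi by move=> x; rewrite /psi /= hE subrK.
have psiK : cancel psi phi.
  move=> [c k]; rewrite /phi proj_psi; congr (_, _).
  by apply: inj_inj; rewrite hE proj_psi addrK.
exists phi; split; first by exists psi.
- split=> x y; apply: (can_inj psiK); rewrite phiK -{1}[x]phiK -{1}[y]phiK.
  + by rewrite {1 2}/psi /= addrACA sec_add addrA -!injD.
  + by rewrite {1 2}/psi /= injlD dotDr injr dot_sec addrA -injD.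
- move=> c; apply: (can_inj psiK); rewrite phiK /psi /=.
  by rewrite addr0.
- by [].
Qed.

End Classification.

(** The invariants are expressed by [ext_add] and [ext_dot] only, so that they can be computed
    directly in a concrete [xi_extension]. *)
Lemma classify (G : zmodType) (E : extension G 'Z_4) :
    is_central_extension dotZ4 E -> forall (e : E) (g g1 g1' : G),
    ext_proj e = 1 -> ext_add (ext_add e e) (ext_add e e) = ext_inj E g ->
    ext_add (ext_dot e e) e = ext_inj E g1 ->
    ext_add (ext_dot (ext_add e e) e) (ext_inj E g1') = e ->
  equivalent_extensions E (xi_extension g1 g1' g).
Proof.
move=> centE; have [M [dot [inj [proj defE]]]] := central_extension_zmod centE.
rewrite {}defE in centE * => /= e g g1 g1' e1 e4 ee e2e.
apply: (classify_equivalent centE e1).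
- by rewrite -e4 (mulrzDr e 2 2).
- by rewrite -ee addrK.
- by rewrite -[X in X - _]e2e addrK.
Qed.

(** * Equivalences between the extensions [xi_extension] *)

Lemma xi_equivalent_shift (G : zmodType) (g g1 g1' t : G) :
    admissible g1 g1' g ->
  equivalent_extensions (xi_extension g1 g1' g)
    (xi_extension (g1 - t *+ 2) g1' (g - t *+ 4)).
Proof.
(* This other element over 1 has invariants g - 4 t, g1 - 2 t and g1'. *)
move=> adm; pose e : xi_extension g1 g1' g := (- t, 1).
apply: (@classify _ _ (xi_central_extension adm) e) => //.
- congr pair; last exact: val_inj.
  rewrite /= /xi1 /= addrACA addrA addrK addrC.
  by rewrite -!opprD -!mulr2n -mulrnA.
- congr pair; last exact: val_inj.
  rewrite /= /xi1 /xi2 /= -[(_ %/ 2)%N]/0%N subr0 addr0.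
  by rewrite addrAC -opprD addrC.
- congr pair; last exact: val_inj.
  by rewrite /= /xi1 /xi2 /= subrK addr0.
Qed.

Lemma xi_equivalent_inv (G : zmodType) (g g1 g1' d d1 d1' : G) :
    equivalent_extensions (xi_extension g1 g1' g) (xi_extension d1 d1' d) ->
  exists t, [/\ g1 - d1 = t *+ 2, g - d = t *+ 4 & d1' = g1'].
Proof.
move=> [phi [_ [phiD phiM] phi_inj phi_proj]].
(* Compatibility with Gamma and the projection forces phi (c, i) = (c + u i, i), so the two cocycles
   differ by the coboundary of u; the shift t will be u 1. *)
pose u i := (phi (0, i)).1.
have phiE i : phi (0, i) = (u i, i).
  by rewrite [LHS]surjective_pairing; congr pair; exact: phi_proj (0, i).
have phi_pair c i : phi (c, i) = (c + u i, i).
  have <- : ext_add (ext_inj (xi_extension g1 g1' g) c) (0, i) = (c, i).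
    by rewrite /= xi1_0l !addr0 add0r.
  by rewrite phiD phi_inj phiE /= xi1_0l addr0 add0r.
have u0 : u 0 = 0 by have := phi_inj 0; rewrite phiE => -[].
have uD i j : xi1 g i j + u (i + j) = u i + u j + xi1 d i j.
  by have := phiD (0, i) (0, j); rewrite !phiE phi_pair addr0 add0r => -[].
have uM i j : xi2 g1 g1' g i j + u (dotZ4 i j) = u j + xi2 d1 d1' d i j.
  by have := phiM (0, i) (0, j); rewrite !phiE phi_pair add0r => -[].
have D11 : g + u 2%:R = u 1 + u 1 + d := uD 1 1.
have D13 : u 3%:R = - u 1.
  have := uD 1 3%:R; rewrite (_ : 1 + 3%:R = 0); last exact: val_inj.
  by rewrite /xi1 /= u0 !addr0 => /esym/eqP; rewrite addrC addr_eq0 => /eqP.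
have D22 : - g = u 2%:R + u 2%:R - d.
  have := uD 2%:R 2%:R; rewrite (_ : 2%:R + 2%:R = 0); last exact: val_inj.
  by rewrite u0 addr0.
have M11 : g1 + u 3%:R = u 1 + d1.
  have := uM 1 1; rewrite (_ : dotZ4 1 1 = 3%:R); last exact: val_inj.
  by rewrite /xi2 /= -[(_ %/ 2)%N]/0%N !subr0.
have M21 : - g1' + u 1 = u 1 - d1'.
  have := uM 2%:R 1; rewrite (_ : dotZ4 2%:R 1 = 1) //; exact: val_inj.
have dgE : d - g = u 2%:R + u 2%:R by rewrite D22 addrC subrK.
(* Substituting d - g = 2 (u 2) into u 2 = 2 (u 1) + d - g gives the value. *)
have u2E : u 2%:R = - (u 1 *+ 2).
  have: u 2%:R = u 1 *+ 2 + d - g by rewrite mulr2n -D11 addrC addKr.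
  rewrite -addrA dgE addrA -{1}[u 2%:R]add0r => /addIr/esym/eqP.
  by rewrite addrC addr_eq0 => /eqP.
exists (u 1); split.
- by move/eqP: M11; rewrite D13 subr_eq => /eqP ->; rewrite addrAC addrK mulr2n.
- by rewrite -opprB dgE u2E opprD opprK -mulr2n -mulrnA.
- by apply/oppr_inj/(addrI (u 1)); rewrite -M21 addrC.
Qed.

Theorem theoremC (Gamma : zmodType) :
  (forall gamma gamma1 gamma1' : Gamma,
     admissible gamma1 gamma1' gamma ->
     is_central_extension dotZ4 (xi_extension gamma1 gamma1' gamma)) /\
  (forall gamma gamma1 gamma1' delta delta1 delta1' : Gamma,
     admissible gamma1 gamma1' gamma ->
     admissible delta1 delta1' delta ->
     (equivalent_extensions (xi_extension gamma1 gamma1' gamma)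
                            (xi_extension delta1 delta1' delta)
      <-> [/\ exists t : Gamma, gamma1 - delta1 = t *+ 2,
              gamma - delta = (gamma1 - delta1) *+ 2 &
              delta1' = gamma1'])) /\
  (forall E : extension Gamma 'Z_4,
     is_central_extension dotZ4 E ->
     exists gamma gamma1 gamma1' : Gamma,
       admissible gamma1 gamma1' gamma /\
       equivalent_extensions E (xi_extension gamma1 gamma1' gamma)).
Proof.
split; first by move=> g g1 g1'; exact: xi_central_extension.
split; last first.
  move=> E centE; have [M [dot [inj [proj defE]]]] := central_extension_zmod centE.
  rewrite {}defE in centE *.
  have [e [g [g1 [g1' [e1 e4 ee e2e]]]]] := generator_data centE.
  exists g, g1, g1'; split.
    exact: (classify_admissible centE e4 ee e2e).
  exact: (classify_equivalent centE e1 e4 ee e2e).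
move=> g g1 g1' d d1 d1' adm _; split.
  move=> /xi_equivalent_inv[t [g1E gE g1'E]].
  by split=> //; [exists t | rewrite gE g1E -mulrnA].
move=> [[t g1E] gE ->].
have -> : d1 = g1 - t *+ 2 by rewrite -g1E subKr.
have -> : d = g - t *+ 4 by rewrite [t *+ 4](mulrnA t 2 2) -g1E -gE subKr.
exact: xi_equivalent_shift.
Qed.
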